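(* In both the Fokker-Planck case (discrete Maxwellian satisfying (A-FP)) and the BGK case (discrete Maxwellian satisfying (A-BGK)), with fixed meshes and time step $\Delta t>0$, the condition number of the linear system of the scheme $(\tilde{\mathbf S}_{\lambda,h}^\varepsilon)$, i.e. of the linear map $A_\varepsilon$ defined in the context, is uniformly bounded with respect to $\varepsilon\in[0,1]$.
   Context: Velocity mesh. Fix $v_\star>0$ and an integer $L\ge1$. Interfaces $v_{j+1/2}$, $j=-L,\dots,L$, are strictly increasing with $v_{-L+1/2}=-v_\star$, $v_{1/2}=0$, $v_{L+1/2}=v_\star$ and $v_{j+1/2}=-v_{-j+1/2}$ for $j=0,\dots,L$. Let $\mathcal J=\{-L+1,\dots,L\}$; for $j\in\mathcal J$ the cell $(v_{j-1/2},v_{j+1/2})$ has length $\Delta v_j$ and midpoint $v_j$. Let $\mathcal J^*=\{-L,\dots,L\}$, $v_{-L}:=-v_\star$, $v_{L+1}:=v_\star$ and $\Delta v_{j+1/2}=v_{j+1}-v_j$ for $j\in\mathcal J^*$. Space mesh. The torus of length $1$ is divided into $N$ consecutive intervals indexed by $\mathcal I=\mathbb Z/N\mathbb Z$, of lengths $\Delta x_i>0$. Discrete Maxwellians. Let $0<\underline m_2\le\overline m_2$ and $\overline m_4$ be fixed constants, and $m_k^{\Delta v}=\sum_{j\in\mathcal J}|v_j|^k\mathcal M_j\Delta v_j$. (A-BGK): $(\mathcal M_j)_{j\in\mathcal J}$ satisfies $\mathcal M_j>0$ for all $j\in\mathcal J$, $\mathcal M_j=\mathcal M_{-j+1}$ for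 $j=1,\dots,L$, $\sum_{j\in\mathcal J}\mathcal M_j\Delta v_j=1$, $\underline m_2\le m_2^{\Delta v}\le\overline m_2$, $m_4^{\Delta v}\le\overline m_4$. (A-FP): $(\mathcal M^*_{j+1/2})_{j\in\mathcal J^*}$ satisfies $\mathcal M^*_{j+1/2}=\mathcal M^*_{-j+1/2}$ for $j\in\mathcal J^*$, $\mathcal M^*_{L+1/2}=\mathcal M^*_{-L+1/2}=0$, $\mathcal M_j:=\frac{\mathcal M^*_{j-1/2}-\mathcal M^*_{j+1/2}}{v_j\Delta v_j}>0$ for $j\in\mathcal J$, $\sum_{j\in\mathcal J}\mathcal M_j\Delta v_j=1$, $\underline m_2\le m_2^{\Delta v}\le\overline m_2$, $m_4^{\Delta v}\le\overline m_4$. The linear system. One time step of $(\tilde{\mathbf S}_{\lambda,h}^\varepsilon)$ is the overdetermined system, for unknowns $(\lambda,h)=(\lambda^{n+1},h^{n+1})\in\mathbb R^{\mathcal I}\times\mathbb R^{\mathcal I\times\mathcal J}$ in terms of $(\lambda^n,h^n)$, given by $A_\varepsilon(\lambda,h)=(\lambda^n,\varepsilon^2h^n,0)$, where $A_\varepsilon:\mathbb R^{\mathcal I}\times\mathbb R^{\mathcal I\times\mathcal J}\to\mathbb R^{\mathcal I}\times\mathbb R^{\mathcal I\times\mathcal J}\times\mathbb R^{\mathcal I}$, $A_\varepsilon(\lambda,h)=(a,b,c)$, with for $i\in\mathcal I$, $j\in\mathcal J$ $$a_i=\lambda_i+\frac{\Delta t}{\Delta x_i}\sum_{j\in\mathcal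 J}\Delta v_jv_j\mathcal M_j\frac{h_{i+1,j}-h_{i-1,j}}2,\qquad c_i=\sum_{j\in\mathcal J}h_{ij}\mathcal M_j\Delta v_j,$$ $$b_{ij}=\varepsilon^2h_{ij}+\frac{\Delta t}{\Delta x_i}v_j\frac{\lambda_{i+1}-\lambda_{i-1}}2+\frac{\varepsilon\Delta t}{\Delta x_i}\left(v_j\frac{h_{i+1,j}-h_{i-1,j}}2-\sum_{k\in\mathcal J}\Delta v_kv_k\mathcal M_k\frac{h_{i+1,k}-h_{i-1,k}}2\right)-\Delta t\,(Qh)_{ij},$$ where in the BGK case $(Qh)_{ij}=-h_{ij}$ and in the Fokker-Planck case $$(Qh)_{ij}=\frac1{\Delta v_j\mathcal M_j}\left(\frac{\mathcal M^*_{j+1/2}}{\Delta v_{j+1/2}}(h_{i,j+1}-h_{ij})-\frac{\mathcal M^*_{j-1/2}}{\Delta v_{j-1/2}}(h_{ij}-h_{i,j-1})\right)$$ (terms containing $\mathcal M^*_{\pm L+1/2}=0$ are zero). For the rectangular map $A_\varepsilon$ the condition number is the ratio of its largest to its smallest singular value (equivalently $\|A_\varepsilon\|\,\|A_\varepsilon^{+}\|$ with $A_\varepsilon^{+}$ the pseudo-inverse and $A_\varepsilon$ injective). *)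

(* Defs.v *)
From HB Require Import structures.
From mathcomp Require Import all_boot all_order all_algebra.
From mathcomp Require Import all_classical all_reals.
From mathcomp Require Import ring.

Set Implicit Arguments.
Unset Strict Implicit.
Unset Printing Implicit Defensive.

Import Order.TTheory GRing.Theory Num.Theory.

Local Open Scope ring_scope.

(* Half-integer indices are shifted: [vhalf j] stands for v_{j+1/2}. Velocity
   data are functions on [int] whose values outside the ranges quantified below
   are irrelevant. *)
Record velocity_mesh (R : realType) := VelocityMesh {
  vstar : R;
  Lv : nat;
  vhalf : int -> R;
  vstar_gt0 : 0 < vstar;
  Lv_ge1 : (1 <= Lv)%N;
  vhalf_incr : forall j k : int,
    - Lv%:Z <= j -> j < k -> k <= Lv%:Z -> vhalf j < vhalf k;
  vhalf_min : vhalf (- Lv%:Z) = - vstar;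
  vhalf0 : vhalf 0 = 0;
  vhalf_max : vhalf Lv%:Z = vstar;
  vhalf_odd : forall j : int, 0 <= j <= Lv%:Z -> vhalf j = - vhalf (- j)
}.

Record space_mesh (R : realType) := SpaceMesh {
  Nx : nat;
  dx : 'I_Nx -> R;
  Nx_gt0 : (0 < Nx)%N;
  dx_gt0 : forall i, 0 < dx i;
  dx_sum : \sum_i dx i = 1
}.

(* The index set {-L+1, ..., L} is enumerated by 'I_(2L): the ordinal [k]
   encodes the cell [cell V k]. *)
Definition cell (R : realType) (V : velocity_mesh R) (k : 'I_((Lv V).*2)) : int :=
  k%:Z - (Lv V)%:Z + 1.

Arguments cell {R} V k.

Definition dv (R : realType) (V : velocity_mesh R) (j : int) : R :=
  vhalf V j - vhalf V (j - 1).

Definition vmid (R : realType) (V : velocity_mesh R) (j : int) : R :=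
  if j == - (Lv V)%:Z then - vstar V
  else if j == (Lv V)%:Z + 1 then vstar V
  else (vhalf V (j - 1) + vhalf V j) / 2.

(* [dvhalf V j] stands for \Delta v_{j+1/2}. *)
Definition dvhalf (R : realType) (V : velocity_mesh R) (j : int) : R :=
  vmid V (j + 1) - vmid V j.

Definition moment (R : realType) (V : velocity_mesh R) (M : int -> R) (p : nat)
    : R :=
  \sum_(k < (Lv V).*2) `|vmid V (cell V k)| ^+ p * M (cell V k) * dv V (cell V k).

Record BGK_maxwellian (R : realType) (V : velocity_mesh R)
    (m2lo m2hi m4hi : R) (M : int -> R) : Prop := BGKMaxwellian {
  BGK_pos : forall k : 'I_((Lv V).*2), 0 < M (cell V k);
  BGK_sym : forall j : int, 1 <= j <= (Lv V)%:Z -> M j = M (- j + 1);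
  BGK_mass : \sum_(k < (Lv V).*2) M (cell V k) * dv V (cell V k) = 1;
  BGK_m2 : m2lo <= moment V M 2 <= m2hi;
  BGK_m4 : moment V M 4 <= m4hi
}.

(* [Ms j] stands for M^*_{j+1/2}. *)
Definition FP_density (R : realType) (V : velocity_mesh R) (Ms : int -> R)
    (j : int) : R :=
  (Ms (j - 1) - Ms j) / (vmid V j * dv V j).

Record FP_maxwellian (R : realType) (V : velocity_mesh R)
    (m2lo m2hi m4hi : R) (Ms : int -> R) : Prop := FPMaxwellian {
  FP_sym : forall j : int, - (Lv V)%:Z <= j <= (Lv V)%:Z -> Ms j = Ms (- j);
  FP_right0 : Ms (Lv V)%:Z = 0;
  FP_left0 : Ms (- (Lv V)%:Z) = 0;
  FP_pos : forall k : 'I_((Lv V).*2), 0 < FP_density V Ms (cell V k);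
  FP_mass : \sum_(k < (Lv V).*2) FP_density V Ms (cell V k) * dv V (cell V k) = 1;
  FP_m2 : m2lo <= moment V (FP_density V Ms) 2 <= m2hi;
  FP_m4 : moment V (FP_density V Ms) 4 <= m4hi
}.

Definition BGK_op (R : realType) (V : velocity_mesh R) (X : space_mesh R)
    (h : 'M[R]_(Nx X, (Lv V).*2)) : 'M[R]_(Nx X, (Lv V).*2) := - h.

(* h_{i,j} for an integer j. The indices j = -L and j = L+1 are not cells; the
   default value 0 used there is only ever multiplied by M^*_{-L+1/2} = 0 or
   M^*_{L+1/2} = 0. *)
Definition hcell (R : realType) (V : velocity_mesh R) (X : space_mesh R)
    (h : 'M[R]_(Nx X, (Lv V).*2)) (i : 'I_(Nx X)) (j : int) : R :=
  if [pick k | cell V k == j] is Some k then h i k else 0.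

Definition FP_op (R : realType) (V : velocity_mesh R) (X : space_mesh R)
    (Ms : int -> R) (h : 'M[R]_(Nx X, (Lv V).*2)) : 'M[R]_(Nx X, (Lv V).*2) :=
  \matrix_(i, k)
    let j := cell V k in
    (dv V j * FP_density V Ms j)^-1 *
    (Ms j / dvhalf V j * (hcell h i (j + 1) - h i k)
     - Ms (j - 1) / dvhalf V (j - 1) * (h i k - hcell h i (j - 1))).

(* [ordS] and [ord_pred] are the cyclic successor and predecessor on 'I_n, so
   that the index i lives in Z/nZ, for every n >= 1. *)
Definition cdiff (R : realType) (n : nat) (u : 'I_n -> R) (i : 'I_n) : R :=
  (u (ordS i) - u (ord_pred i)) / 2.

Definition flux (R : realType) (V : velocity_mesh R) (X : space_mesh R)
    (M : int -> R) (h : 'M[R]_(Nx X, (Lv V).*2)) (i : 'I_(Nx X)) : R :=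
  \sum_(k < (Lv V).*2)
    dv V (cell V k) * vmid V (cell V k) * M (cell V k) * cdiff (h^~ k) i.

(* The map A_eps : (lambda, h) |-> (a, b, c), for a density M and a collision
   operator Q. *)
Definition scheme_map (R : realType) (V : velocity_mesh R) (X : space_mesh R)
    (dt : R) (M : int -> R)
    (Q : 'M[R]_(Nx X, (Lv V).*2) -> 'M[R]_(Nx X, (Lv V).*2)) (eps : R)
    (y : 'rV[R]_(Nx X) * 'M[R]_(Nx X, (Lv V).*2)) :
    'rV[R]_(Nx X) * 'M[R]_(Nx X, (Lv V).*2) * 'rV[R]_(Nx X) :=
  let: (lam, h) := y in
  ( \row_i (lam 0 i + dt / dx i * flux M h i),
    \matrix_(i, k)
      (eps ^+ 2 * h i k
       + dt / dx i * (vmid V (cell V k) * cdiff (lam 0) i)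
       + eps * dt / dx i
         * (vmid V (cell V k) * cdiff (h^~ k) i - flux M h i)
       - dt * Q h i k),
    \row_i \sum_(k < (Lv V).*2) h i k * M (cell V k) * dv V (cell V k) ).

(* Coordinates in the canonical bases, one per unknown or equation, so that the
   singular values below refer to the unweighted Euclidean norms. *)
Definition unvec_in (R : realType) (n m : nat) (u : 'rV[R]_(n + n * m)) :
    'rV[R]_n * 'M[R]_(n, m) :=
  (lsubmx u, vec_mx (rsubmx u)).

Definition vec_out (R : realType) (n m : nat)
    (z : 'rV[R]_n * 'M[R]_(n, m) * 'rV[R]_n) : 'rV[R]_((n + n * m) + n) :=
  let: (a, b, c) := z in row_mx (row_mx a (mxvec b)) c.

(* [lin1_mx] acts on row vectors, whence the transpose: the matrix of A_eps acts
   on column vectors (see [scheme_mxE]). *)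
Definition scheme_mx (R : realType) (V : velocity_mesh R) (X : space_mesh R)
    (dt : R) (M : int -> R)
    (Q : 'M[R]_(Nx X, (Lv V).*2) -> 'M[R]_(Nx X, (Lv V).*2)) (eps : R) :
    'M[R]_((Nx X + Nx X * (Lv V).*2) + Nx X, Nx X + Nx X * (Lv V).*2) :=
  (lin1_mx (fun u => vec_out (scheme_map dt M Q eps (unvec_in u))))^T.

Definition BGK_mx (R : realType) (V : velocity_mesh R) (X : space_mesh R)
    (dt : R) (M : int -> R) (eps : R) :=
  scheme_mx dt M (@BGK_op R V X) eps.

Definition FP_mx (R : realType) (V : velocity_mesh R) (X : space_mesh R)
    (dt : R) (Ms : int -> R) (eps : R) :=
  scheme_mx dt (FP_density V Ms) (@FP_op R V X Ms) eps.

(* For A : R^n -> R^m these are the n square roots of the eigenvalues of A^T A,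
   hence 0 is among them exactly when A is not injective. *)
Definition singular_values (R : realType) (m n : nat) (A : 'M[R]_(m, n)) : set R :=
  [set s | 0 <= s /\ eigenvalue (A^T *m A) (s ^+ 2)]%classic.

(* The set of singular values is finite, so [sup] and [inf] are its largest and
   smallest elements. The value is +oo if A is not injective. *)
Definition cond_number (R : realType) (m n : nat) (A : 'M[R]_(m, n)) : \bar R :=
  let smax := sup (singular_values A) in
  let smin := inf (singular_values A) in
  if smin == 0 then +oo%E else (smax / smin)%:E.

Lemma cdiff_lin (R : realType) (n : nat) (a : R) (u v w : 'I_n -> R) i :
  (forall j, w j = a * u j + v j) -> cdiff w i = a * cdiff u i + cdiff v i.
Proof. by move=> E; rewrite /cdiff !E; field. Qed.

Lemma hcell_lin (R : realType) (V : velocity_mesh R) (X : space_mesh R) a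
    (h g : 'M[R]_(Nx X, (Lv V).*2)) i j :
  hcell (a *: h + g) i j = a * hcell h i j + hcell g i j.
Proof.
by rewrite /hcell; case: pickP => [k _|_]; rewrite ?mxE // mulr0 addr0.
Qed.

Lemma BGK_op_lin (R : realType) (V : velocity_mesh R) (X : space_mesh R) :
  linear (@BGK_op R V X).
Proof. by move=> a h g; rewrite /BGK_op opprD scalerN. Qed.

Lemma FP_op_lin (R : realType) (V : velocity_mesh R) (X : space_mesh R) Ms :
  linear (@FP_op R V X Ms).
Proof.
move=> a h g; apply/matrixP => i k; rewrite !mxE /= !hcell_lin.
by ring.
Qed.

Lemma flux_lin (R : realType) (V : velocity_mesh R) (X : space_mesh R)
    (M : int -> R) a (h g : 'M[R]_(Nx X, (Lv V).*2)) i :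
  flux M (a *: h + g) i = a * flux M h i + flux M g i.
Proof.
rewrite /flux mulr_sumr -big_split /=; apply: eq_bigr => k _.
rewrite (@cdiff_lin _ _ a (h^~ k) (g^~ k)); first by ring.
by move=> j; rewrite !mxE.
Qed.

Lemma vec_scheme_lin (R : realType) (V : velocity_mesh R) (X : space_mesh R)
    (dt : R) (M : int -> R)
    (Q : 'M[R]_(Nx X, (Lv V).*2) -> 'M[R]_(Nx X, (Lv V).*2)) (eps : R) :
  linear Q ->
  linear (fun u => vec_out (scheme_map dt M Q eps (unvec_in u))).
Proof.
move=> Qlin a u v; rewrite /vec_out /scheme_map /unvec_in /=.
rewrite !linearP /= Qlin.
rewrite !scale_row_mx !add_row_mx; congr (row_mx (row_mx _ _) _).
- by apply/rowP => i; rewrite !mxE flux_lin; ring.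
- rewrite -[RHS]linearP /=; congr mxvec; apply/matrixP => i k.
  rewrite !mxE flux_lin.
  rewrite (@cdiff_lin _ _ a (lsubmx u 0) (lsubmx v 0)
    ((a *: lsubmx u + lsubmx v) 0));
    last by move=> j; rewrite !mxE.
  rewrite (@cdiff_lin _ _ a ((vec_mx (rsubmx u))^~ k)
    ((vec_mx (rsubmx v))^~ k) 
    ((a *: vec_mx (rsubmx u) + vec_mx (rsubmx v))^~ k));
    last by move=> j; rewrite !mxE.
  by ring.
- apply/rowP => i; rewrite !mxE mulr_sumr -big_split /=.
  by apply: eq_bigr => k _; rewrite !mxE; ring.
Qed.

Lemma scheme_mxE (R : realType) (V : velocity_mesh R) (X : space_mesh R)
    (dt : R) (M : int -> R)
    (Q : 'M[R]_(Nx X, (Lv V).*2) -> 'M[R]_(Nx X, (Lv V).*2)) (eps : R) lam h :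
  linear Q ->
  scheme_mx dt M Q eps *m (row_mx lam (mxvec h))^T
  = (vec_out (scheme_map dt M Q eps (lam, h)))^T.
Proof.
move=> /(vec_scheme_lin dt M eps) Flin; rewrite /scheme_mx -trmx_mul.
pose F := fun u => vec_out (scheme_map dt M Q eps (unvec_in u)).
pose FL := GRing.isLinear.Build _ _ _ _ F Flin.
pose G : {linear 'rV[R]_(Nx X + Nx X * (Lv V).*2) ->
    'rV[R]_((Nx X + Nx X * (Lv V).*2) + Nx X)} := HB.pack F FL.
by rewrite (mul_rV_lin1 G) /= /F /unvec_in row_mxKl row_mxKr mxvecK.
Qed.

(* Main.v *)
(* Testing a against lambda and b against h in the norms weighted by dx and
   M dv, and adding a multiple of the flux tested against c, cancels all
   transport terms and leaves |lambda|^2 + eps^2 |h|^2 - dt <Q h, h>, where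
   <Q h, h> <= 0. This vanishes only if lambda = 0 and <Q h, h> = 0; then h does
   not depend on the velocity, and c = 0 forces h = 0. Thus A_eps is injective
   for every eps, eps = 0 included. Since its entries are polynomials in eps, the
   determinant of its Gram matrix is continuous without zero on [0, 1], hence
   bounded away from 0, and the eigenvalues of the Gram matrix stay in a compact
   subset of ]0, +oo[. *)
Require Import Defs.
From HB Require Import structures.
From mathcomp Require Import all_boot all_order all_algebra.
From mathcomp Require Import all_classical all_reals.
From mathcomp Require Import complex topology normedtype derive.
From mathcomp Require Import zify ring lra.

Set Implicit Arguments.
Unset Strict Implicit.
Unset Printing Implicit Defensive.

Import Order.TTheory GRing.Theory Num.Theory.
Import numFieldNormedType.Exports.

Local Open Scope ring_scope.

(** * Spectra of real symmetric matrices and of Gram matrices *)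

(* [singular_values] has to be shown nonempty: on the empty set [inf] is 0 and
   [cond_number] would be +oo. *)
Lemma sym_eigenvalue_exists (R : rcfType) (n : nat) (S : 'M[R]_n) :
  (0 < n)%N -> S^T = S -> exists a : R, eigenvalue S a.
Proof.
move=> n_gt0 symS; pose SC : 'M[R[i]]_n := map_mx (real_complex R) S.
have [z z_eigen] := @spectral.eigenvalue_closed _ _ SC n_gt0.
have /eigenvalueP[v vS v_neq0] := z_eigen.
(* Over the complex numbers an eigenvector [v] exists. As [S] is Hermitian and [q], the squared norm
   of [v], is real and nonzero, [z * q] equals its own conjugate, so [z] is real. *)
pose q := \sum_i v 0 i * (v 0 i)^*.
have q_neq0 : q != 0.
  apply: contraNneq v_neq0 => q0; apply/eqP/rowP => i; rewrite mxE.
  have /eqP := psumr_eq0P (fun i _ => mul_conjC_ge0 (v 0 i)) q0 (i := i) isT.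
  by rewrite mul_conjC_eq0 => /eqP.
have zq : z * q = \sum_i \sum_j v 0 j * SC j i * (v 0 i)^*.
  rewrite mulr_sumr; apply: eq_bigr => i _.
  rewrite -mulr_suml mulrA; congr (_ * _).
  by have /rowP/(_ i) := vS; rewrite !mxE.
have realS i j : (SC i j)^* = SC j i.
  by rewrite !mxE -{2}symS mxE; apply/conj_Creal/complex_realP; exists (S i j).
have q_real : q^* = q.
  by rewrite rmorph_sum /=; apply: eq_bigr => i _; rewrite rmorphM /= conjCK mulrC.
have z_real : z^* = z.
  apply: (mulIf q_neq0); rewrite -{1}q_real -rmorphM zq [RHS]exchange_big /=.
  rewrite rmorph_sum /=; apply: eq_bigr => i _.
  rewrite rmorph_sum /=; apply: eq_bigr => j _.
  by rewrite !rmorphM /= conjCK realS mulrC [_ * SC i j]mulrC mulrA.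
have /complex_realP[a za] : z \is Num.real by apply/CrealP.
by exists a; move: z_eigen; rewrite za (eigenvalue_map (real_complex R)).
Qed.

Lemma eigenvalue_norm_le (R : realFieldType) (n : nat) (S : 'M[R]_n) (a K : R) :
  (forall i j, `|S i j| <= K) -> eigenvalue S a -> `|a| <= n%:R * K.
Proof.
move=> SK /eigenvalueP[v vS v_neq0].
have [i0 vi0] : exists i, v 0 i != 0.
  apply/existsP; apply: contraNT v_neq0 => /existsPn v0.
  by apply/eqP/rowP => i; rewrite mxE; apply/eqP; have := v0 i; rewrite negbK.
(* The eigenvalue equation is read at a coordinate where the eigenvector has largest modulus. *)
pose i := [arg max_(i > i0) `|v 0 i|]%O.
have vmax k : `|v 0 k| <= `|v 0 i|.
  by rewrite /i; case: arg_maxP => // j _ /(_ k isT).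
have vi_gt0 : 0 < `|v 0 i| by apply: lt_le_trans (vmax i0); rewrite normr_gt0.
rewrite -(ler_pM2r vi_gt0) -normrM.
have /rowP/(_ i) := vS; rewrite !mxE => <-.
apply: le_trans (ler_norm_sum _ _ _) _.
apply: (@le_trans _ _ (\sum_(k < n) K * `|v 0 i|)).
  by apply: ler_sum => k _; rewrite normrM mulrC ler_pM.
by rewrite sumr_const card_ord -mulrA mulr_natl.
Qed.

(** Multiplying v S = a v by the adjugate gives det S v = a (v adj S), so the same [v] serves for
    both matrices. An upper bound on the adjugate thus becomes a lower bound on [a]. *)
Lemma eigenvalue_adj (F : fieldType) (n : nat) (S : 'M[F]_n) (a : F) :
  \det S != 0 -> eigenvalue S a ->
  a != 0 /\ eigenvalue (\adj S) (\det S / a).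
Proof.
move=> dS /eigenvalueP[v vS v_neq0].
have vadj : \det S *: v = a *: (v *m \adj S).
  by rewrite -mul_mx_scalar -mul_mx_adj mulmxA vS scalemxAl.
have a_neq0 : a != 0.
  apply: contraNneq v_neq0 => a0; move: vadj; rewrite a0 scale0r => /eqP.
  by rewrite scaler_eq0 (negbTE dS).
split=> //; apply/eigenvalueP; exists v => //.
by rewrite mulrC -scalerA vadj scalerA mulVf // scale1r.
Qed.

Lemma row_sqr_ge0 (R : realFieldType) (n : nat) (x : 'rV[R]_n) :
  0 <= (x *m x^T) 0 0.
Proof. by rewrite mxE sumr_ge0 // => i _; rewrite mxE -expr2 sqr_ge0. Qed.

Lemma row_sqr_eq0 (R : realFieldType) (n : nat) (x : 'rV[R]_n) :
  (x *m x^T) 0 0 = 0 -> x = 0.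
Proof.
rewrite mxE => x0; apply/rowP => i; rewrite mxE.
have := psumr_eq0P _ x0 (i := i) isT; rewrite mxE => H; apply/eqP.
by rewrite -sqrf_eq0 expr2 H // => j _; rewrite mxE -expr2 sqr_ge0.
Qed.

Lemma gram_det_neq0 (R : realFieldType) (m n : nat) (A : 'M[R]_(m, n)) :
  (forall u : 'cV[R]_n, A *m u = 0 -> u = 0) -> \det (A^T *m A) != 0.
Proof.
move=> injA; apply/negP => /det0P[v v_neq0 vS].
(* If v kills the Gram matrix, then |v A^T|^2 = v A^T A v^T = 0. *)
case/eqP: v_neq0; rewrite -[v]trmxK (injA v^T) ?trmx0 //.
apply: trmx_inj; rewrite trmx_mul trmxK trmx0; apply: row_sqr_eq0.
by rewrite trmx_mul trmxK !mulmxA -(mulmxA v) vS mul0mx mxE.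
Qed.

Lemma gram_eigenvalue_ge0 (R : realFieldType) (m n : nat) (A : 'M[R]_(m, n)) a :
  eigenvalue (A^T *m A) a -> 0 <= a.
Proof.
case/eigenvalueP=> v vS v_neq0.
have v_gt0 : 0 < (v *m v^T) 0 0.
  rewrite lt_def row_sqr_ge0 andbT.
  by apply: contraNneq v_neq0 => /row_sqr_eq0 ->.
have := row_sqr_ge0 (v *m A^T).
by rewrite trmx_mul trmxK mulmxA -(mulmxA v) vS -scalemxAl mxE pmulr_lge0.
Qed.

Lemma cond_number_le (R : realType) (m n : nat) (A : 'M[R]_(m, n)) (lo hi : R) :
  (0 < n)%N -> 0 < lo -> 0 <= hi ->
  (forall a, eigenvalue (A^T *m A) a -> lo <= a <= hi) ->
  (cond_number A <= (Num.sqrt hi / Num.sqrt lo)%:E)%E.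
Proof.
move=> n_gt0 lo_gt0 hi_ge0 eigA; set sv := singular_values A.
have sv_neq0 : (sv !=set0)%classic.
  have [|a a_eigen] := @sym_eigenvalue_exists R n (A^T *m A) n_gt0.
    by rewrite trmx_mul trmxK.
  exists (Num.sqrt a); split; first exact: sqrtr_ge0.
  by rewrite sqr_sqrtr // (gram_eigenvalue_ge0 a_eigen).
have sv_le s : sv s -> Num.sqrt lo <= s <= Num.sqrt hi.
  case=> s_ge0 /eigA/andP[los shi].
  by rewrite -(ger0_norm s_ge0) -sqrtr_sqr !ler_wsqrtr.
have inf_ge : Num.sqrt lo <= inf sv.
  by apply: lb_le_inf => // s /sv_le/andP[].
have sup_le : sup sv <= Num.sqrt hi.
  by apply: ge_sup => // s /sv_le/andP[].
have slo_gt0 : 0 < Num.sqrt lo by rewrite sqrtr_gt0.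
have inf_gt0 := lt_le_trans slo_gt0 inf_ge.
rewrite /cond_number -/sv gt_eqF // lee_fin.
apply: (@le_trans _ _ (Num.sqrt hi / inf sv)).
  by rewrite ler_wpM2r // invr_ge0 ltW.
by rewrite ler_wpM2l ?sqrtr_ge0 // lef_pV2 // posrE.
Qed.

(** * Uniform bounds for matrices depending polynomially on a parameter in [0, 1] *)

Lemma poly_bounded_on_unit (R : realFieldType) (p : {poly R}) :
  exists2 K : R, 0 <= K & forall t, 0 <= t <= 1 -> `|p.[t]| <= K.
Proof.
exists (\sum_(i < size p) `|p`_i|); first exact: sumr_ge0.
move=> t /andP[t0 t1]; rewrite horner_coef; apply: le_trans (ler_norm_sum _ _ _) _.
apply: ler_sum => i _; rewrite normrM ler_piMr // normrX ger0_norm //.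
exact: exprn_ile1.
Qed.

Lemma mxpoly_bounded_on_unit (R : realFieldType) (m n : nat)
    (P : 'M[{poly R}]_(m, n)) :
  exists2 K : R, 0 <= K &
    forall t, 0 <= t <= 1 -> forall i j, `|(P i j).[t]| <= K.
Proof.
have /choice[K HK] : forall ij : 'I_m * 'I_n, exists K : R, 0 <= K /\
    forall t, 0 <= t <= 1 -> `|(P ij.1 ij.2).[t]| <= K.
  by move=> [i j]; have [K] := poly_bounded_on_unit (P i j); exists K.
exists (\sum_ij K ij); first by apply: sumr_ge0 => ij _; case: (HK ij).
move=> t t01 i j; rewrite (bigD1 (i, j)) //=.
apply: le_trans (_ : K (i, j) <= _); first by case: (HK (i, j)) => _; apply.
by rewrite lerDl sumr_ge0 // => ij _; case: (HK ij).
Qed.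

Lemma poly_norm_ge_on_unit (R : realType) (p : {poly R}) :
  (forall t, 0 <= t <= 1 -> p.[t] != 0) ->
  exists2 d : R, 0 < d & forall t, 0 <= t <= 1 -> d <= `|p.[t]|.
Proof.
move=> p_neq0.
(* The square of [p] is minimised in place of its absolute value: it is again a polynomial, hence
   continuous. *)
have [|c c01 cmin] := @EVT_min R (fun t => (p ^+ 2).[t]) 0 1 ler01.
  by apply: continuous_subspaceT; exact: continuous_horner.
exists `|p.[c]|.
  by rewrite normr_gt0 p_neq0 // -in_itv.
move=> t t01; rewrite -ler_sqr ?nnegrE // !real_normK ?num_real //.
by rewrite -!horner_exp; apply: cmin; rewrite in_itv.
Qed.

(* Every eigenvalue a of the Gram matrix S is at least of the order of \det S,
   because \det S / a is an eigenvalue of \adj S; and \det S is a polynomial in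
   t without zero on [0, 1]. *)
Lemma cond_number_poly_bounded (R : realType) (m n : nat)
    (A : R -> 'M[R]_(m, n)) :
  (0 < n)%N ->
  (forall i j, exists p : {poly R}, forall t, A t i j = p.[t]) ->
  (forall t, 0 <= t <= 1 -> forall u : 'cV[R]_n, A t *m u = 0 -> u = 0) ->
  exists C : R, forall t, 0 <= t <= 1 -> (cond_number (A t) <= C%:E)%E.
Proof.
move=> n_gt0 polyA injA.
have /choice[p Ap] : forall ij : 'I_m * 'I_n,
    exists p : {poly R}, forall t, A t ij.1 ij.2 = p.[t] by case.
pose P : 'M[{poly R}]_(m, n) := \matrix_(i, j) p (i, j).
pose S := P^T *m P.
have AE t : A t = map_mx (horner_eval t) P.
  by apply/matrixP => i j; rewrite !mxE horner_evalE -(Ap (i, j)).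
have SE t : (A t)^T *m A t = map_mx (horner_eval t) S.
  by rewrite AE map_mxM map_trmx.
have [d d_gt0 Sd] : exists2 d : R, 0 < d &
    forall t, 0 <= t <= 1 -> d <= `|(\det S).[t]|.
  apply: poly_norm_ge_on_unit => t t01.
  by rewrite -horner_evalE -det_map_mx -SE gram_det_neq0 //; exact: injA.
have [K K_ge0 SK] := mxpoly_bounded_on_unit S.
have [K' K'_ge0 SK'] := mxpoly_bounded_on_unit (\adj S).
(* The added 1 keeps [hi'] positive even if [K'] is 0. *)
pose hi := n%:R * K; pose hi' := n%:R * K' + 1.
have hi'_gt0 : 0 < hi' by rewrite ltr_wpDl // mulr_ge0.
exists (Num.sqrt hi / Num.sqrt (d / hi')) => t t01.
apply: cond_number_le => //; [exact: divr_gt0|exact: mulr_ge0|move=> a a_eigen].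
have a_ge0 := gram_eigenvalue_ge0 a_eigen.
rewrite SE in a_eigen; apply/andP; split; last first.
  rewrite -(ger0_norm a_ge0); apply: eigenvalue_norm_le a_eigen => i j.
  by rewrite mxE; exact: SK.
have dSt : \det (map_mx (horner_eval t) S) = (\det S).[t] by rewrite det_map_mx.
have [|a_neq0] := eigenvalue_adj _ a_eigen.
  by rewrite dSt -normr_gt0 (lt_le_trans d_gt0 (Sd t t01)).
rewrite dSt -map_mx_adj => /(eigenvalue_norm_le (K := K')) H.
have {H}: `|(\det S).[t] / a| <= n%:R * K'.
  by apply: H => i j; rewrite mxE; exact: SK'.
have a_gt0 : 0 < a by rewrite lt_def a_neq0.
rewrite normrM normfV (ger0_norm a_ge0) ler_pdivrMr // => H.
rewrite ler_pdivrMr // (le_trans (Sd t t01)) // (le_trans H) // mulrC.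
by rewrite ler_wpM2l // lerDl.
Qed.

(** * The scheme: dependence on [eps], energy identity, injectivity *)

Lemma scheme_mx_poly (R : realType) (V : velocity_mesh R) (X : space_mesh R)
    (dt : R) (M : int -> R)
    (Q : 'M[R]_(Nx X, (Lv V).*2) -> 'M[R]_(Nx X, (Lv V).*2)) i j :
  exists p : {poly R}, forall eps, scheme_mx dt M Q eps i j = p.[eps].
Proof.
(* Column [j] of the matrix is the image of the [j]-th basis vector. Its c and a blocks do not
   involve [eps]; its b block is quadratic in it. *)
pose lam := (unvec_in (delta_mx 0 j : 'rV[R]_(Nx X + Nx X * (Lv V).*2))).1.
pose h := (unvec_in (delta_mx 0 j : 'rV[R]_(Nx X + Nx X * (Lv V).*2))).2.
suff [p Hp] : exists p : {poly R}, forall eps,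
    vec_out (scheme_map dt M Q eps (lam, h)) 0 i = p.[eps].
  by exists p => eps; rewrite -Hp !mxE.
case: (split_ordP i) => {}i ->; last first.
  by eexists (_)%:P => eps; rewrite /= row_mxEr hornerC mxE.
case: (split_ordP i) => {}i ->.
  by eexists (_)%:P => eps; rewrite /= row_mxEl row_mxEl hornerC mxE.
case/mxvec_indexP: i => r k.
exists ((h r k) *: 'X^2 + (dt / dx r * (vmid V (cell V k) * cdiff (lam 0) r))%:P
   + (dt / dx r * (vmid V (cell V k) * cdiff (h^~ k) r - flux M h r)) *: 'X
   - (dt * Q h r k)%:P) => eps.
rewrite /= row_mxEl row_mxEr mxvecE mxE.
by rewrite !(hornerD, hornerN, hornerZ, hornerC, hornerX, hornerXn); ring.
Qed.

(** Summation by parts on the torus: [ordS] and [ord_pred] are inverse bijections, so reindexing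
    moves each shift to the other factor without boundary terms. *)
Lemma sum_cdiff_skew (R : realType) (n : nat) (u w : 'I_n -> R) :
  \sum_i u i * cdiff w i = - \sum_i cdiff u i * w i.
Proof.
have shift (f g : 'I_n -> R) :
    \sum_i f i * g (ordS i) = \sum_i f (ord_pred i) * g i.
  rewrite [RHS](reindex (@ordS n)) /=; last exact: onW_bij (ordS_bij n).
  by apply: eq_bigr => i _; rewrite ordSK.
have split_diff (f g : 'I_n -> R) : \sum_i f i * cdiff g i
    = (\sum_i f i * g (ordS i) - \sum_i f i * g (ord_pred i)) / 2.
  by rewrite -sumrB mulr_suml; apply: eq_bigr => i _; rewrite /cdiff; field.
rewrite split_diff; under [in RHS]eq_bigr => i _ do rewrite mulrC.
rewrite split_diff -mulNr opprB; congr ((_ - _) / _).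
  by rewrite shift; apply: eq_bigr => i _; rewrite mulrC.
by rewrite shift; apply: eq_bigr => i _; rewrite mulrC.
Qed.

Lemma sum_cdiff_self (R : realType) (n : nat) (u : 'I_n -> R) :
  \sum_i u i * cdiff u i = 0.
Proof.
have := sum_cdiff_skew u u; under [X in _ = - X]eq_bigr => i _ do rewrite mulrC.
lra.
Qed.

Definition cell_weight (R : realType) (V : velocity_mesh R) (M : int -> R) k :=
  M (cell V k) * dv V (cell V k).

Arguments cell_weight {R} V M k.

(* The centered differences are skew-symmetric, so that the transport
   terms cancel, except for the last one in b, which is compensated by c. *)
Lemma scheme_energy (R : realType) (V : velocity_mesh R) (X : space_mesh R)
    (dt : R) (M : int -> R)
    (Q : 'M[R]_(Nx X, (Lv V).*2) -> 'M[R]_(Nx X, (Lv V).*2)) (eps : R)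
    (lam : 'rV[R]_(Nx X)) (h : 'M[R]_(Nx X, (Lv V).*2)) :
  let z := scheme_map dt M Q eps (lam, h) in
  let w := cell_weight V M in
  \sum_i dx i * (lam 0 i * z.1.1 0 i)
  + \sum_i \sum_k dx i * (w k * (h i k * z.1.2 i k))
  + eps * dt * \sum_i flux M h i * z.2 0 i
  = \sum_i dx i * lam 0 i ^+ 2
    + eps ^+ 2 * \sum_i \sum_k dx i * (w k * h i k ^+ 2)
    - dt * \sum_i dx i * \sum_k w k * (h i k * Q h i k).
Proof.
move=> z w.
(* The weight [dx i] cancels the factor 1 / [dx i] of the transport terms, which makes the skewness
   of [cdiff] applicable on a nonuniform mesh. *)
have dx_neq0 (i : 'I_(Nx X)) : dx i != 0 by rewrite gt_eqF // dx_gt0.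
pose v k := vmid V (cell V k).
have fluxE i : flux M h i = \sum_k w k * v k * cdiff (h^~ k) i.
  by apply: eq_bigr => k _; rewrite /w /v /cell_weight; ring.
have transport_lam : \sum_i lam 0 i * flux M h i
    = - \sum_i \sum_k w k * v k * (cdiff (lam 0) i * h i k).
  under eq_bigr => i _ do rewrite fluxE mulr_sumr.
  rewrite exchange_big [in RHS]exchange_big -sumrN /=; apply: eq_bigr => k _.
  under eq_bigr => i _ do rewrite mulrCA.
  by rewrite -!mulr_sumr sum_cdiff_skew mulrN.
have transport_h : \sum_i \sum_k w k * v k * (h i k * cdiff (h^~ k) i) = 0.
  rewrite exchange_big big1 //= => k _.
  by rewrite -mulr_sumr (sum_cdiff_self (h^~ k)) mulr0.
have Ea : \sum_i dx i * (lam 0 i * z.1.1 0 i)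
    = \sum_i dx i * lam 0 i ^+ 2 + dt * \sum_i lam 0 i * flux M h i.
  rewrite mulr_sumr -big_split /=; apply: eq_bigr => i _.
  by rewrite mxE; field; exact: dx_neq0.
have Eb : \sum_i \sum_k dx i * (w k * (h i k * z.1.2 i k))
    = eps ^+ 2 * (\sum_i \sum_k dx i * (w k * h i k ^+ 2))
    + dt * (\sum_i \sum_k w k * v k * (cdiff (lam 0) i * h i k))
    + eps * dt * (\sum_i \sum_k w k * v k * (h i k * cdiff (h^~ k) i))
    - eps * dt * (\sum_i flux M h i * \sum_k w k * h i k)
    - dt * \sum_i dx i * \sum_k w k * (h i k * Q h i k).
  rewrite !mulr_sumr -!big_split -!sumrB /=; apply: eq_bigr => i _.
  rewrite !mulr_sumr -!big_split -!sumrB /=; apply: eq_bigr => k _.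
  by rewrite mxE -/(v k); field; exact: dx_neq0.
(* This is the product left in [Eb] by the subtracted flux, which does not depend on the
   velocity. *)
have Ec : \sum_i flux M h i * z.2 0 i = \sum_i flux M h i * \sum_k w k * h i k.
  apply: eq_bigr => i _; rewrite mxE; congr (_ * _).
  by apply: eq_bigr => k _; rewrite /w /cell_weight; ring.
by rewrite Ea Eb Ec transport_lam transport_h; ring.
Qed.

(** What the energy argument asks of a collision operator. The second clause is coercivity on
    mean-zero functions of the velocity, without a constant: compactness in [eps] later supplies the
    uniformity. *)
Definition dissipative (R : realType) (V : velocity_mesh R) (X : space_mesh R)
    (M : int -> R) (Q : 'M[R]_(Nx X, (Lv V).*2) -> 'M[R]_(Nx X, (Lv V).*2)) :=
  forall (h : 'M[R]_(Nx X, (Lv V).*2)) (i : 'I_(Nx X)),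
  [/\ \sum_k cell_weight V M k * (h i k * Q h i k) <= 0
    & \sum_k cell_weight V M k * (h i k * Q h i k) = 0 ->
      \sum_k cell_weight V M k * h i k = 0 -> forall k, h i k = 0].

Lemma scheme_map_inj (R : realType) (V : velocity_mesh R) (X : space_mesh R)
    (dt : R) (M : int -> R)
    (Q : 'M[R]_(Nx X, (Lv V).*2) -> 'M[R]_(Nx X, (Lv V).*2)) (eps : R)
    (lam : 'rV[R]_(Nx X)) (h : 'M[R]_(Nx X, (Lv V).*2)) :
  0 < dt -> (forall k, 0 < cell_weight V M k) -> dissipative M Q ->
  scheme_map dt M Q eps (lam, h) = (0, 0, 0) -> lam = 0 /\ h = 0.
Proof.
move=> dt_gt0 w_gt0 dissQ z0; have := scheme_energy dt M Q eps lam h.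
rewrite z0 /= (@big1 _ _ _ _ _ _ (fun i => dx i * (lam 0 i * _))); last first.
  by move=> i _; rewrite mxE !mulr0.
rewrite big1; last by move=> i _; rewrite big1 // => k _; rewrite mxE !mulr0.
rewrite big1; last by move=> i _; rewrite mxE !mulr0.
rewrite mulr0 !addr0.
set A := \sum_i dx i * lam 0 i ^+ 2; set B := \sum_i \sum_k _.
set D := \sum_i dx i * \sum_k _ => E.
have dx_ge0 (i : 'I_(Nx X)) : 0 <= dx i by rewrite ltW ?dx_gt0.
have A_pos i : 0 <= dx i * lam 0 i ^+ 2 by rewrite mulr_ge0 ?sqr_ge0.
have D_pos i : 0 <= - (dx i * \sum_k cell_weight V M k * (h i k * Q h i k)).
  by rewrite -mulrN mulr_ge0 // oppr_ge0; case: (dissQ h i).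
have A_ge0 : 0 <= A by apply: sumr_ge0.
have B_ge0 : 0 <= eps ^+ 2 * B.
  rewrite mulr_ge0 ?sqr_ge0 // sumr_ge0 // => i _; rewrite sumr_ge0 // => k _.
  by rewrite mulr_ge0 // mulr_ge0 ?sqr_ge0 // ltW.
have D_ge0 : 0 <= - D by rewrite -sumrN sumr_ge0.
have dtD_ge0 : 0 <= dt * - D by rewrite mulr_ge0 // ltW.
(* Three nonnegative terms sum to 0. The term with [B] says nothing about [h] when [eps] is 0, so
   [h] is recovered from the dissipation [D] and from c = 0. *)
have A0 : A = 0 by lra.
have D0 : - D = 0.
  have : dt * - D = 0 by lra.
  by move/eqP; rewrite mulf_eq0 gt_eqF //= => /eqP.
split.
  apply/rowP => i; rewrite mxE; apply/eqP; rewrite -sqrf_eq0.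
  have /eqP := psumr_eq0P (fun i _ => A_pos i) A0 (i := i) isT.
  by rewrite mulf_eq0 gt_eqF ?dx_gt0.
apply/matrixP => i k; rewrite mxE; case: (dissQ h i) => _; apply.
  rewrite -sumrN in D0.
  have /eqP := psumr_eq0P (fun i _ => D_pos i) D0 (i := i) isT.
  by rewrite oppr_eq0 mulf_eq0 gt_eqF ?dx_gt0 //= => /eqP.
have /rowP/(_ i) : (scheme_map dt M Q eps (lam, h)).2 = 0 by rewrite z0.
rewrite !mxE => c0; rewrite -[RHS]c0.
by apply: eq_bigr => l _; rewrite /cell_weight; ring.
Qed.

Lemma scheme_mx_inj (R : realType) (V : velocity_mesh R) (X : space_mesh R)
    (dt : R) (M : int -> R)
    (Q : 'M[R]_(Nx X, (Lv V).*2) -> 'M[R]_(Nx X, (Lv V).*2)) (eps : R)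
    (u : 'cV[R]_(Nx X + Nx X * (Lv V).*2)) :
  0 < dt -> (forall k, 0 < cell_weight V M k) -> linear Q -> dissipative M Q ->
  scheme_mx dt M Q eps *m u = 0 -> u = 0.
Proof.
move=> dt_gt0 w_gt0 Qlin dissQ.
pose lam := lsubmx u^T; pose h : 'M_(Nx X, (Lv V).*2) := vec_mx (rsubmx u^T).
have uE : u = (row_mx lam (mxvec h))^T by rewrite vec_mxK hsubmxK trmxK.
rewrite {1}uE scheme_mxE // => /(congr1 trmx); rewrite trmxK trmx0 => z0.
have [||||lam0 h0] := @scheme_map_inj R V X dt M Q eps lam h => //.
  move: z0; case: (scheme_map _ _ _ _ _) => [[a b] c] /=.
  rewrite -[0 in RHS]row_mx0 => /eq_row_mx[].
  rewrite -[0 in RHS]row_mx0 => /eq_row_mx[-> b0 ->].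
  by rewrite -[b]mxvecK b0 linear0.
by rewrite uE lam0 h0 linear0 row_mx0 trmx0.
Qed.

Lemma scheme_cond_bounded (R : realType) (V : velocity_mesh R) (X : space_mesh R)
    (dt : R) (M : int -> R)
    (Q : 'M[R]_(Nx X, (Lv V).*2) -> 'M[R]_(Nx X, (Lv V).*2)) :
  0 < dt -> (forall k, 0 < cell_weight V M k) -> linear Q -> dissipative M Q ->
  exists C : R, forall eps : R, 0 <= eps <= 1 ->
    (cond_number (scheme_mx dt M Q eps) <= C%:E)%E.
Proof.
move=> dt_gt0 w_gt0 Qlin dissQ; apply: cond_number_poly_bounded.
- by rewrite addn_gt0 Nx_gt0.
- by move=> i j; exact: scheme_mx_poly.
- by move=> t _ u; exact: scheme_mx_inj.
Qed.

(** * The BGK operator *)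

Lemma dv_gt0 (R : realType) (V : velocity_mesh R) k : 0 < dv V (cell V k).
Proof.
rewrite subr_gt0; have := ltn_ord k; rewrite /cell => kL.
by apply: vhalf_incr; lia.
Qed.

Lemma BGK_dissipative (R : realType) (V : velocity_mesh R) (X : space_mesh R)
    (M : int -> R) :
  (forall k, 0 < cell_weight V M k) -> dissipative M (@BGK_op R V X).
Proof.
move=> w_gt0 h i.
have sumE : \sum_k cell_weight V M k * (h i k * BGK_op h i k)
    = - \sum_k cell_weight V M k * h i k ^+ 2.
  by rewrite -sumrN; apply: eq_bigr => k _; rewrite !mxE; ring.
have pos k : 0 <= cell_weight V M k * h i k ^+ 2.
  by rewrite mulr_ge0 ?sqr_ge0 // ltW.
rewrite sumE; split; first by rewrite oppr_le0 sumr_ge0.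
move/eqP; rewrite oppr_eq0 => /eqP s0 _ k; apply/eqP; rewrite -sqrf_eq0.
have /eqP := psumr_eq0P (fun k _ => pos k) s0 (i := k) isT.
by rewrite mulf_eq0 gt_eqF.
Qed.

(** * The Fokker-Planck operator *)

Lemma summation_by_parts (R : comPzRingType) (n : nat) (f G : nat -> R) :
  \sum_(k < n.+1) f k * (G k.+1 - G k)
  = f n * G n.+1 - f 0%N * G 0%N - \sum_(k < n) G k.+1 * (f k.+1 - f k).
Proof.
elim: n => [|n IHn]; first by rewrite big_ord1 big_ord0; ring.
by rewrite big_ord_recr IHn big_ord_recr /=; ring.
Qed.

Section FokkerPlanck.

Variables (R : realType) (V : velocity_mesh R) (Ms : int -> R).
Variables (m2lo m2hi m4hi : R).
Hypothesis MsP : FP_maxwellian V m2lo m2hi m4hi Ms.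

Let Lz : int := (Lv V)%:Z.

Lemma vmidE (j : int) :
  - Lz < j <= Lz -> vmid V j = (vhalf V (j - 1) + vhalf V j) / 2.
Proof. by move=> jL; rewrite /vmid ifF ?ifF //; apply/eqP; lia. Qed.

Lemma dvhalf_gt0 (j : int) : - Lz < j < Lz -> 0 < dvhalf V j.
Proof.
move=> jL; rewrite /dvhalf !vmidE; try lia.
have : vhalf V (j - 1) < vhalf V j by apply: vhalf_incr; lia.
have : vhalf V j < vhalf V (j + 1) by apply: vhalf_incr; lia.
by rewrite addrK; lra.
Qed.

Lemma vmid_gt0 (j : int) : 0 < j <= Lz -> 0 < vmid V j.
Proof.
move=> jL; rewrite vmidE; last lia.
have v0 := vhalf0 V.
have vj : 0 < vhalf V j by rewrite -v0; apply: vhalf_incr; lia.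
have : 0 <= vhalf V (j - 1).
  case: (eqVneq j 1) => [->|j1]; first by rewrite subrr v0.
  by rewrite -v0 ltW //; apply: vhalf_incr; lia.
lra.
Qed.

Lemma cell_surj (j : int) : - Lz < j <= Lz -> exists k, cell V k = j.
Proof.
move=> jL; have kL : (absz (j + Lz - 1)%R < (Lv V).*2)%N by rewrite -addnn; lia.
by exists (Ordinal kL); rewrite /cell /=; lia.
Qed.

(** Positivity of the density makes [Ms] strictly decreasing where the velocity is positive. Since
    [Ms] ends at 0 at the index L, it is positive before; symmetry gives the negative indices. *)
Lemma FP_flux_coef_gt0 (j : int) : - Lz < j < Lz -> 0 < Ms j.
Proof.
have decr (i : int) : 0 < i <= Lz -> Ms i < Ms (i - 1).
  move=> iL; have [|k ki] := @cell_surj i; first lia.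
  have := FP_pos MsP k; rewrite /FP_density ki.
  by rewrite pmulr_lgt0 ?subr_gt0 // invr_gt0 mulr_gt0 ?vmid_gt0 // -ki dv_gt0.
have pos (n : nat) : (n < Lv V)%N -> 0 < Ms (Lz - n.+1%:Z).
  elim: n => [|n IHn] nL.
    by rewrite -(FP_right0 MsP); apply: decr; lia.
  have -> : Lz - n.+2%:Z = (Lz - n.+1%:Z) - 1 by lia.
  by apply: lt_trans (decr _ _); [apply: IHn; lia | lia].
have pos' (i : int) : 0 <= i < Lz -> 0 < Ms i.
  move=> iL; have -> : i = Lz - (absz (Lz - i - 1)%R).+1%:Z by lia.
  by apply: pos; lia.
move=> jL; case: (leP 0 j) => j0; first by apply: pos'; lia.
by rewrite (FP_sym MsP); [apply: pos'; lia | lia].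
Qed.

Lemma FP_weight_gt0 k : 0 < cell_weight V (FP_density V Ms) k.
Proof. by rewrite mulr_gt0 ?dv_gt0 ?(FP_pos MsP). Qed.

Lemma hcellE (X : space_mesh R) (h : 'M[R]_(Nx X, (Lv V).*2)) i k :
  hcell h i (cell V k) = h i k.
Proof.
rewrite /hcell; case: pickP => [l /eqP|/(_ k)]; last by rewrite eqxx.
by rewrite /cell => kl; congr (h i _); apply: val_inj => /=; lia.
Qed.

(** Summation by parts turns the dissipation into minus a sum of squared jumps with positive
    coefficients over the interior interfaces. If it vanishes, [h] is constant in the velocity, and
    the zero mean makes this constant 0. *)
Lemma FP_dissipative (X : space_mesh R) :
  dissipative (FP_density V Ms) (@FP_op R V X Ms).
Proof.
move=> h i; have w_gt0 := FP_weight_gt0.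
(* Cells are counted from 0: [j n] is the interface to the left of cell [n], [f n] the value in that
   cell and [G n] the flux through that interface. *)
pose j (n : nat) : int := n%:Z - Lz.
pose f (n : nat) := hcell h i (j n + 1).
pose g (n : nat) := Ms (j n) / dvhalf V (j n).
pose G (n : nat) := g n * (f n - hcell h i (j n)).
(* The 2L cells are separated by [n] = 2L - 1 interior interfaces. *)
have [n nL] : exists n, (Lv V).*2 = n.+1.
  by exists (Lv V).*2.-1; have := Lv_ge1 V; lia.
have fE (k : 'I_(Lv V).*2) : f k = h i k.
  by rewrite /f -hcellE /cell; congr hcell; rewrite /j; lia.
have jS m : j m.+1 = j m + 1 by rewrite /j; lia.
have sumE : \sum_k cell_weight V (FP_density V Ms) k * (h i k * FP_op Ms h i k)
    = - \sum_(m < n) g m.+1 * (f m.+1 - f m) ^+ 2.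
  transitivity (\sum_(k < n.+1) f k * (G k.+1 - G k)).
    rewrite -nL; apply: eq_bigr => k _; rewrite mxE.
    have cellE : cell V k = j k.+1 by rewrite /cell /j; lia.
    rewrite /cell_weight /G /g -fE jS cellE jS addrK.
    have W_neq0 : FP_density V Ms (j k + 1) * dv V (j k + 1) != 0.
      by rewrite gt_eqF // -jS -cellE; exact: w_gt0.
    have -> : f k.+1 = hcell h i (j k + 1 + 1) by rewrite /f jS.
    have -> : hcell h i (j k + 1) = f k by [].
    by rewrite [dv V _ * _]mulrC mulrCA mulVKf.
  rewrite summation_by_parts.
  (* At both outer interfaces the jump contains the default value of [hcell], but [Ms] vanishes
     there. *)
  have -> : G n.+1 = 0.
    rewrite /G /g; have -> : j n.+1 = Lz by rewrite /j -nL -addnn /Lz; lia.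
    by rewrite (FP_right0 MsP) !mul0r.
  have -> : G 0%N = 0.
    rewrite /G /g; have -> : j 0%N = - Lz by rewrite /j; lia.
    by rewrite (FP_left0 MsP) !mul0r.
  rewrite !mulr0 subrr sub0r; congr (- _); apply: eq_bigr => m _.
  have fm : hcell h i (j m.+1) = f m by rewrite jS.
  by rewrite /G fm; ring.
have g_gt0 (m : 'I_n) : 0 < g m.+1.
  have mL := ltn_ord m; move: nL; rewrite -addnn => nL.
  by rewrite divr_gt0 ?FP_flux_coef_gt0 ?dvhalf_gt0 //; rewrite /j /Lz; lia.
have pos (m : 'I_n) : 0 <= g m.+1 * (f m.+1 - f m) ^+ 2.
  by rewrite mulr_ge0 ?sqr_ge0 // ltW.
rewrite sumE; split; first by rewrite oppr_le0 sumr_ge0.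
move/eqP; rewrite oppr_eq0 => /eqP s0 mean0.
have f_const m : (m <= n)%N -> f m = f 0%N.
  elim: m => // m IHm mn; rewrite -IHm; last lia.
  have /eqP := psumr_eq0P (fun k _ => pos k) s0 (i := Ordinal mn) isT.
  by rewrite mulf_eq0 (gt_eqF (g_gt0 (Ordinal mn))) sqrf_eq0 subr_eq0 => /eqP.
have h_const k : h i k = f 0%N.
  by rewrite -fE f_const //; have := ltn_ord k; lia.
(* With unit mass, the mean of a constant is that constant. *)
have mass : \sum_k cell_weight V (FP_density V Ms) k = 1 by exact: FP_mass MsP.
move=> k; rewrite h_const -[RHS]mean0.
under eq_bigr => l _ do rewrite h_const.
by rewrite -mulr_suml mass mul1r.
Qed.

End FokkerPlanck.

Theorem corollary2 (R : realType) (V : velocity_mesh R) (X : space_mesh R)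
    (dt m2lo m2hi m4hi : R)
    (dt_gt0 : 0 < dt) (m2lo_gt0 : 0 < m2lo) (m2lo_le : m2lo <= m2hi) :
  (forall Ms : int -> R, FP_maxwellian V m2lo m2hi m4hi Ms ->
     exists C : R, forall eps : R, 0 <= eps <= 1 ->
       (cond_number (FP_mx V X dt Ms eps) <= C%:E)%E)
  /\
  (forall M : int -> R, BGK_maxwellian V m2lo m2hi m4hi M ->
     exists C : R, forall eps : R, 0 <= eps <= 1 ->
       (cond_number (BGK_mx V X dt M eps) <= C%:E)%E).
Proof.
split=> M MP.
  apply: scheme_cond_bounded => //.
  - by move=> k; exact: FP_weight_gt0 MP k.
  - exact: FP_op_lin.
  - exact: FP_dissipative MP X.
have w_gt0 k : 0 < cell_weight V M k by rewrite mulr_gt0 ?dv_gt0 ?(BGK_pos MP).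
apply: scheme_cond_bounded => //; first exact: BGK_op_lin.
exact: BGK_dissipative.
Qed.
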